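(* Let $n\ge 10$. The graph $G(5,n)$ is bipartite with partite sets $X=\{v\equiv 0\pmod 4\}$ and $Y=\{v\equiv 2\pmod 4\}$, and its vertex set can be partitioned into an independent set $I$ and two sets inducing paths $Q_1$ and $Q_2$ such that every vertex of $Q_1$ is adjacent to all vertices of $I$ and all vertices of $Q_2$ lying in the partite set opposite to it, and every vertex of $Q_2$ is adjacent to all vertices of $I$ and all vertices of $Q_1$ lying in the partite set opposite to it; these together with the edges of $Q_1$ and $Q_2$ are all the edges of $G(5,n)$. Moreover, $G(5,1)\cong K_1$, $G(5,2)\cong K_2$, $G(5,3)\cong P_3$, $G(5,4)\cong C_4$, $G(5,5)\cong K_{2,3}$, $G(5,6)\cong K_{3,3}$, $G(5,7)\cong K_{3,4}$, $G(5,8)$ is obtained from $K_{4,4}$ by deleting exactly one edge, and $G(5,9)$ is obtained from $K_{4,5}$ by deleting two disjoint edges.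
   Context: For a prime $p$ and $n\in\mathbb{N}$, $G(p,n)$ is the simple graph with vertex set $\{2,4,\ldots,2n\}$ in which two distinct vertices $a,b$ are adjacent if and only if both $\frac{a+b}{2}$ and $\frac{|a-b|}{2}$ are odd positive integers neither of which equals $pk$ for an integer $k\ge 2$. $P_k$ is the path on $k$ vertices, $C_k$ the cycle on $k$ vertices, $K_{r,s}$ the complete bipartite graph. *)

(* Defs.v *)
From HB Require Import structures.
From mathcomp Require Import all_boot all_order ssralg ssrint.

Set Implicit Arguments.
Unset Strict Implicit.
Unset Printing Implicit Defensive.

Record sgraph := SGraph {
  svertex :> finType;
  adj : rel svertex;
  adj_sym : symmetric adj;
  adj_irr : irreflexive adj }.

Definition graph_iso (G H : sgraph) : Prop :=
  exists f : G -> H, bijective f /\ forall x y, adj (f x) (f y) = adj x y.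

Definition edge_set (G : sgraph) : {set {set G}} :=
  [set e | [exists x : G, exists y : G, adj x y && (e == [set x; y])]].

Section InducedDeleted.
Variable G : sgraph.

Definition induced_adj (S : {set G}) : rel {x : G | x \in S} :=
  fun x y => adj (val x) (val y).

Fact induced_sym S : symmetric (@induced_adj S).
Proof. by move=> x y; exact: adj_sym. Qed.

Fact induced_irr S : irreflexive (@induced_adj S).
Proof. by move=> x; exact: adj_irr. Qed.

Definition induced (S : {set G}) : sgraph :=
  SGraph (@induced_sym S) (@induced_irr S).

Definition del_adj (F : {set {set G}}) : rel G :=
  fun x y => adj x y && ([set x; y] \notin F).

Fact del_sym F : symmetric (del_adj F).
Proof. by move=> x y; rewrite /del_adj adj_sym setUC. Qed.

Fact del_irr F : irreflexive (del_adj F).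
Proof. by move=> x; rewrite /del_adj adj_irr. Qed.

Definition del_edges (F : {set {set G}}) : sgraph :=
  SGraph (del_sym F) (del_irr F).

Definition independent (S : {set G}) : Prop :=
  forall x y, x \in S -> y \in S -> ~~ adj x y.

(* [partition] already asks for nonempty, pairwise disjoint, covering blocks;
   [uniq] rules out two of the listed sets being the same block. *)
Definition partition_into (s : seq {set G}) : bool :=
  uniq s && partition [set:: s] [set: G].

Definition bipartite_with (X Y : {set G}) : Prop :=
  [/\ partition_into [:: X; Y], independent X & independent Y].

Definition opposite (X Y : {set G}) (x y : G) : bool :=
  (x \in X) && (y \in Y) || (x \in Y) && (y \in X).

End InducedDeleted.

Definition complete_adj m : rel 'I_m := fun x y => x != y.

Fact complete_sym m : symmetric (@complete_adj m).
Proof. by move=> x y; rewrite /complete_adj eq_sym. Qed.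

Fact complete_irr m : irreflexive (@complete_adj m).
Proof. by move=> x; rewrite /complete_adj eqxx. Qed.

Definition complete_graph m : sgraph :=
  SGraph (@complete_sym m) (@complete_irr m).

Definition path_adj k : rel 'I_k :=
  fun x y => (y == x.+1 :> nat) || (x == y.+1 :> nat).

Fact path_sym k : symmetric (@path_adj k).
Proof. by move=> x y; rewrite /path_adj orbC. Qed.

Fact path_irr k : irreflexive (@path_adj k).
Proof. by move=> x; rewrite /path_adj orbb ltn_eqF. Qed.

Definition path_graph k : sgraph := SGraph (@path_sym k) (@path_irr k).

Definition induces_path (G : sgraph) (S : {set G}) : Prop :=
  exists2 k, 0 < k & graph_iso (induced S) (path_graph k).

(* A genuine cycle only for 3 <= k. *)
Definition cycle_adj k : rel 'I_k := fun x y =>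
  (x != y) && ((y == x.+1 %% k :> nat) || (x == y.+1 %% k :> nat)).

Fact cycle_sym k : symmetric (@cycle_adj k).
Proof. by move=> x y; rewrite /cycle_adj eq_sym orbC. Qed.

Fact cycle_irr k : irreflexive (@cycle_adj k).
Proof. by move=> x; rewrite /cycle_adj eqxx. Qed.

Definition cycle_graph k : sgraph := SGraph (@cycle_sym k) (@cycle_irr k).

Definition biclique_adj r s : rel ('I_r + 'I_s)%type := fun x y =>
  match x, y with
  | inl _, inr _ | inr _, inl _ => true
  | _, _ => false
  end.

Fact biclique_sym r s : symmetric (@biclique_adj r s).
Proof. by case=> x; case=> y. Qed.

Fact biclique_irr r s : irreflexive (@biclique_adj r s).
Proof. by case. Qed.

Definition biclique r s : sgraph :=
  SGraph (@biclique_sym r s) (@biclique_irr r s).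

(* m = p k for some integer k >= 2; for p > 0 the bound k <= m loses nothing,
   see [proper_multipleP]. *)
Definition proper_multiple (p m : nat) : bool :=
  [exists k : 'I_m.+1, (2 <= k) && (m == p * k)].

Lemma proper_multipleP p m : 0 < p ->
  reflect (exists2 k, 2 <= k & m = p * k) (proper_multiple p m).
Proof.
move=> p_gt0; apply: (iffP existsP) => [[k /andP[k2 /eqP mE]]|[k k2 mE]].
  by exists k.
have km : k < m.+1 by rewrite ltnS mE leq_pmull.
by exists (Ordinal km); rewrite /= k2 mE eqxx.
Qed.

Definition admissible (p m : nat) : bool :=
  [&& 0 < m, odd m & ~~ proper_multiple p m].

Section PrimeGraph.
Variables p n : nat.

Definition label_type := {v : 'I_(2 * n).+1 | (0 < v) && ~~ odd v}.

Definition label (v : label_type) : nat := val (val v).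

(* The labels are even, so both halvings are exact. *)
Definition Gpn_adj : rel label_type := fun a b =>
  [&& a != b, admissible p ((label a + label b) %/ 2)
    & admissible p (`|label a - label b|%N %/ 2)].

Fact Gpn_sym : symmetric Gpn_adj.
Proof. by move=> a b; rewrite /Gpn_adj eq_sym addnC distnC. Qed.

Fact Gpn_irr : irreflexive Gpn_adj.
Proof. by move=> a; rewrite /Gpn_adj eqxx. Qed.

Definition Gpn : sgraph := SGraph Gpn_sym Gpn_irr.

Definition mod4_part (r : nat) : {set Gpn} :=
  [set v : Gpn | label v == r %[mod 4]].

End PrimeGraph.

(* Main.v *)
Require Import Defs.
From HB Require Import structures.
From mathcomp Require Import all_boot all_order ssralg ssrint.
From mathcomp Require Import intdiv zify.

(** Halve the labels, so that the vertices become 1, ..., n.  For odd p, the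
    vertices i and j are adjacent when i + j is odd and neither i + j nor |i - j|
    is a multiple of p other than p itself.  Group the vertices by their distance
    to the nearest multiple of p: i and j are in the same class iff p divides
    i + j or |i - j|, so two distinct classes are completely joined up to parity.
    In the class of 0 both i + j and |i - j| are multiples of p, and they cannot
    both equal p, so there is no edge.  In a class r with 0 < r < p / 2, give each
    vertex the sign making it congruent to r modulo p: adjacency then means that
    the signed vertices differ by exactly p, so the class is a path.  For p = 5
    the classes are those of 0, 1 and 2.  For small n the only multiple of p that
    can forbid an edge is i + j = 3p. *)

Set Implicit Arguments.
Unset Strict Implicit.
Unset Printing Implicit Defensive.

(** * Vertex labellings and partitions of graphs *)

Definition labels (V T : Type) (P : pred T) (l : V -> T) : Prop :=
  injective l /\ forall t, P t <-> exists v, l v = t.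

Lemma graph_iso_labels (G H : sgraph) (T : eqType) (P : pred T) (a : rel T)
    (l : G -> T) (e : H -> T) :
    labels P l -> labels P e ->
    (forall x y, adj x y = a (l x) (l y)) ->
    (forall x y, adj x y = a (e x) (e y)) ->
  graph_iso G H.
Proof.
move=> [l_inj lP] [e_inj eP] adjl adje.
have to_H x : exists y, e y == l x.
  have /eP[y ey] : P (l x) by apply/lP; exists x.
  by exists y; apply/eqP.
have to_G y : exists x, l x == e y.
  have /lP[x lx] : P (e y) by apply/eP; exists y.
  by exists x; apply/eqP.
have to_HE x : e (xchoose (to_H x)) = l x by apply/eqP/(xchooseP (to_H x)).
have to_GE y : l (xchoose (to_G y)) = e y by apply/eqP/(xchooseP (to_G y)).
exists (fun x => xchoose (to_H x)); split=> [|x y]; last first.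
  by rewrite adje !to_HE adjl.
exists (fun y => xchoose (to_G y)) => [x|y].
- by apply: l_inj; rewrite to_GE to_HE.
- by apply: e_inj; rewrite to_HE to_GE.
Qed.

Lemma labels_induced (G : sgraph) (T : Type) (P A : pred T) (l : G -> T) :
    labels P l ->
  labels (predI P A) (fun v : induced [set v | A (l v)] => l (val v)).
Proof.
move=> [l_inj lP]; split=> [u v /l_inj/val_inj // | t]; split.
  move=> /andP[/lP[v <-] Av]; have vA : v \in [set v | A (l v)] by rewrite inE.
  by exists (exist _ v vA).
move=> [[v vA] <-] /=; apply/andP; split; first by apply/lP; exists v.
by rewrite inE in vA.
Qed.

Lemma partition_into_fibers (G : sgraph) (T : eqType) (c : G -> T) (s : seq T) :
    uniq s -> (forall x, c x \in s) ->
    (forall i, i \in s -> exists x, c x = i) ->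
  partition_into [seq [set x | c x == i] | i <- s].
Proof.
move=> s_uniq c_in_s c_onto; apply/andP; split.
  rewrite map_inj_in_uniq // => i j si _ /setP eq_ij.
  have [x cx] := c_onto i si.
  by move: (eq_ij x); rewrite !inE cx eqxx => /esym/eqP.
apply/and3P; split.
- apply/eqP/setP=> x; rewrite in_setT; apply/bigcupP.
  exists [set y | c y == c x]; last by rewrite inE.
  by rewrite inE; apply/mapP; exists (c x).
- apply/trivIsetP=> A B; rewrite !inE => /mapP[i _ ->] /mapP[j _ ->] neq_AB.
  rewrite -setI_eq0; apply: contraNT neq_AB => /set0Pn[x].
  by rewrite !inE => /andP[/eqP<- /eqP<-].
- rewrite inE; apply/mapP=> -[i si /setP fiber0]; have [x cx] := c_onto i si.
  by move: (fiber0 x); rewrite !inE cx eqxx.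
Qed.

Lemma partition_into_cover (G : sgraph) (s : seq {set G}) (x : G) :
  partition_into s -> has (fun A : {set G} => x \in A) s.
Proof.
case/andP=> _ /and3P[/eqP cover_s _ _].
have : x \in cover [set:: s] by rewrite cover_s inE.
by case/bigcupP=> A; rewrite inE => sA xA; apply/hasP; exists A.
Qed.

Lemma bipartite_opposite (G : sgraph) (X Y : {set G}) (u v : G) :
  bipartite_with X Y -> adj u v -> opposite X Y u v.
Proof.
case=> XY indX indY uv.
have := partition_into_cover u XY; have := partition_into_cover v XY.
rewrite /opposite /= !orbF; case/orP=> [vX|vY]; case/orP=> [uX|uY].
- by rewrite (negPf (indX u v uX vX)) in uv.
- by rewrite uY vX orbT.
- by rewrite uX vY.
- by rewrite (negPf (indY u v uY vY)) in uv.
Qed.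

Lemma edge_bipartite_partition3 (G : sgraph) (X Y I Q1 Q2 e : {set G}) :
    bipartite_with X Y -> partition_into [:: I; Q1; Q2] -> independent I ->
    e \in edge_set G ->
  exists u v : G, e = [set u; v] /\
    [\/ [/\ u \in Q1, v \in I :|: Q2 & opposite X Y u v],
        [/\ u \in Q2, v \in I :|: Q1 & opposite X Y u v],
        u \in Q1 /\ v \in Q1
      | u \in Q2 /\ v \in Q2].
Proof.
move=> XY IQ indI; rewrite inE => /existsP[u /existsP[v /andP[uv /eqP->]]].
wlog uNI : u v uv / u \notin I.
  move=> wlog_uNI; case: (boolP (u \in I)) => [uI|]; last exact: wlog_uNI.
  rewrite setUC; apply: wlog_uNI; first by rewrite adj_sym.
  by apply: contraTN uv => vI; apply: indI.
exists u, v; split=> //; have opp := bipartite_opposite XY uv.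
have := partition_into_cover u IQ; have := partition_into_cover v IQ.
rewrite /= (negPf uNI) !orbF !in_setU /= => /or3P[] vA /orP[] uB.
- by constructor 1; rewrite vA.
- by constructor 2; rewrite vA.
- by constructor 3.
- by constructor 2; rewrite vA orbT.
- by constructor 1; rewrite vA orbT.
- by constructor 4.
Qed.

(** * Adjacency of half labels *)

Lemma admissibleE p m :
  0 < p -> admissible p m = odd m && ((p %| m) ==> (m == p)).
Proof.
move=> p_gt0; rewrite /admissible andbA.
case: (boolP (odd m)) => [m_odd|]; last by rewrite andbF.
rewrite odd_gt0 //= implybE -[m == p]negbK -negb_and; congr (~~ _).
apply/proper_multipleP/andP => // [[k k_ge2 ->]|[/dvdnP[k mE] m_neqp]].
  by rewrite dvdn_mulr //; split=> //; nia.
exists k; last by rewrite mulnC.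
case: k mE => [|[|k]] // mE; first by rewrite mE in m_odd.
by rewrite mE mul1n eqxx in m_neqp.
Qed.

Lemma admissible_lt5p p m :
  odd p -> m < 5 * p -> admissible p m = odd m && (m != 3 * p).
Proof.
move=> p_odd m_lt; rewrite admissibleE ?odd_gt0 //.
case: (boolP (odd m)) => //= m_odd.
case: (boolP (p %| m)) => [/dvdnP[k mE]|p_ndvd_m].
  have k_lt5 : k < 5 by nia.
  move: m_odd; rewrite mE oddM => /andP[].
  by case: k k_lt5 mE => [|[|[|[|[|]]]]] //; nia.
by apply/esym; apply: contraNneq p_ndvd_m => ->; exact: dvdn_mull.
Qed.

Lemma absz_addB_cases (x y : int) :
  `|x| + `|y| = `|(x + y)%R| /\ `| `|x| - `|y| | = `|(x - y)%R| \/
  `|x| + `|y| = `|(x - y)%R| /\ `| `|x| - `|y| | = `|(x + y)%R|.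
Proof. by case: (eqVneq (`|x| + `|y|) `|(x + y)%R|); lia. Qed.

Definition half_adj (p : nat) : rel nat :=
  fun i j => admissible p (i + j) && admissible p `|i - j|.

Lemma half_adj_absz p (x y : int) :
  half_adj p `|x| `|y| = admissible p `|(x + y)%R| && admissible p `|(x - y)%R|.
Proof.
by rewrite /half_adj; case: (absz_addB_cases x y) => -[-> ->]; rewrite // andbC.
Qed.

Definition dist_multiple (p i : nat) : nat := minn (i %% p) (p - i %% p).

Lemma dist_multiple_eq0 p i : 0 < p -> (dist_multiple p i == 0) = (p %| i).
Proof.
by move=> p_gt0; rewrite /dist_multiple /dvdn; have := ltn_pmod i p_gt0; lia.
Qed.

Lemma eq_dist_multiple p i j : 0 < p ->
  (dist_multiple p i == dist_multiple p j) = (p %| i + j) || (p %| `|i - j|).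
Proof.
move=> p_gt0.
have -> : (p %| `|i - j|) = (i %% p == j %% p).
  by rewrite -[LHS]/(p %| ((i : int) - (j : int))%R)%Z -eqz_mod_dvd !modz_nat.
have -> : (p %| i + j) = (i %% p + j %% p == 0) || (i %% p + j %% p == p).
  have : i %% p + j %% p < 2 * p.
    by rewrite mul2n -addnn -addSn leq_add ?ltn_pmod // ltnW ?ltn_pmod.
  rewrite /dvdn -modnDm; move: (i %% p + j %% p) => r r_lt2.
  have [r_lt|r_ge] := ltnP r p; first by rewrite modn_small //; lia.
  by rewrite -{1}(subnK r_ge) modnDr modn_small; lia.
rewrite /dist_multiple; have := ltn_pmod i p_gt0; have := ltn_pmod j p_gt0.
by move: (i %% p) (j %% p) => r s; lia.
Qed.

Lemma dist_multiple_absz p r (x : int) : 0 < p -> 2 * r <= p ->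
  (dist_multiple p `|x| == r) = (p %| `|(x + r%:Z)%R|) || (p %| `|(x - r%:Z)%R|).
Proof.
move=> p_gt0 r_le; have {1}<- : dist_multiple p r = r.
  by rewrite /dist_multiple modn_small; lia.
rewrite eq_dist_multiple //.
by case: (absz_addB_cases x r%:Z) => -[-> ->]; rewrite // orbC.
Qed.

Lemma half_adj_neq_dist p i j : 0 < p ->
  dist_multiple p i != dist_multiple p j -> half_adj p i j = odd (i + j).
Proof.
move=> p_gt0; rewrite eq_dist_multiple // negb_or => /andP[ndvd_add ndvd_sub].
rewrite /half_adj !admissibleE // (negPf ndvd_add) (negPf ndvd_sub) /= !andbT.
lia.
Qed.

Lemma half_adj_dvd p i j :
  0 < p -> 0 < i -> 0 < j -> p %| i -> p %| j -> half_adj p i j = false.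
Proof.
move=> p_gt0 i_gt0 j_gt0 p_dvd_i p_dvd_j.
have p_dvd_sub : p %| `|i - j|.
  by rewrite -[_ %| _]/(p %| ((i : int) - (j : int))%R)%Z GRing.rpredB.
rewrite /half_adj !admissibleE // dvdn_add // p_dvd_sub /=; lia.
Qed.

Lemma half_adj_congruent p (x y : int) : odd p ->
  p %| `|(x - y)%R| -> ~~ (p %| `|(x + y)%R|) ->
  half_adj p `|x| `|y| = (`|(x - y)%R| == p).
Proof.
move=> p_odd dvd_sub ndvd_add.
rewrite half_adj_absz !admissibleE ?odd_gt0 // dvd_sub (negPf ndvd_add) /= andbT.
case: eqP => [subE|]; rewrite ?andbF // andbT; lia.
Qed.

Lemma half_adj_lt5p p i j : odd p -> 0 < i <= 3 * p -> 0 < j <= 3 * p ->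
  i + j < 5 * p -> half_adj p i j = odd (i + j) && (i + j != 3 * p).
Proof.
move=> p_odd i_bound j_bound sum_lt5; rewrite /half_adj !admissible_lt5p //; lia.
Qed.

Lemma half_adj_lt3p p i j : odd p -> 0 < i -> 0 < j ->
  i + j < 3 * p -> half_adj p i j = odd (i + j).
Proof. by move=> p_odd i_gt0 j_gt0 sum_lt3; rewrite half_adj_lt5p //; lia. Qed.

Definition half_label p n (v : Gpn p n) : nat := label v %/ 2.

Lemma labelE p n (v : Gpn p n) : label v = 2 * half_label v.
Proof.
by rewrite /half_label /label; case: v => -[m m_lt] /= /andP[_ m_even]; lia.
Qed.

Lemma labels_half_label p n :
  labels (fun i => 0 < i <= n) (@half_label p n).
Proof.
split=> [u v uv|i].
  by apply/val_inj/val_inj; rewrite /= -!/(label _) !labelE uv.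
split=> [i_bound|[v <-]].
  have i_lt : 2 * i < (2 * n).+1 by lia.
  have i_label : (0 < Ordinal i_lt) && ~~ odd (Ordinal i_lt) by rewrite /=; lia.
  by exists (exist _ (Ordinal i_lt) i_label); rewrite /half_label /label /= mulKn.
by rewrite /half_label /label; case: v => -[m m_lt] /= /andP[m_gt0 m_even]; lia.
Qed.

Lemma half_label_bound p n (v : Gpn p n) : 0 < half_label v <= n.
Proof. by have [_ labelP] := labels_half_label p n; apply/labelP; exists v. Qed.

Lemma adj_half_label p n (u v : Gpn p n) :
  adj u v = half_adj p (half_label u) (half_label v).
Proof.
rewrite /= /Gpn_adj !labelE /half_adj -mulnDr mulKn //.
have -> : `|2 * half_label u - 2 * half_label v|
          = 2 * `|half_label u - half_label v| by lia.
by rewrite mulKn //; case: eqVneq => // ->; rewrite distnn andbF.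
Qed.

Lemma in_mod4_part0 p n (v : Gpn p n) :
  (v \in mod4_part p n 0) = ~~ odd (half_label v).
Proof. by rewrite inE labelE; lia. Qed.

Lemma in_mod4_part2 p n (v : Gpn p n) :
  (v \in mod4_part p n 2) = odd (half_label v).
Proof. by rewrite inE labelE; lia. Qed.

Lemma opposite_mod4_part p n (u v : Gpn p n) :
  opposite (mod4_part p n 0) (mod4_part p n 2) u v
  = odd (half_label u + half_label v).
Proof. by rewrite /opposite !in_mod4_part0 !in_mod4_part2; lia. Qed.

Lemma bipartite_mod4_part p n :
  2 <= n -> bipartite_with (mod4_part p n 0) (mod4_part p n 2).
Proof.
move=> n_ge2; have [_ half_labelP] := labels_half_label p n.
have adj_odd (u v : Gpn p n) : adj u v -> odd (half_label u + half_label v).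
  by rewrite adj_half_label => /andP[/and3P[]].
split.
- apply: (@partition_into_fibers _ _
            (fun v : Gpn p n => label v %% 4) [:: 0; 2]) => //.
    by move=> v; rewrite !inE labelE; lia.
  move=> i; rewrite !inE => i_02.
  have /half_labelP[v vE] : 0 < 2 - i %/ 2 <= n by lia.
  by exists v; rewrite labelE vE; lia.
- move=> u v; rewrite !in_mod4_part0 => u_even v_even.
  by apply/negP => /adj_odd; lia.
- move=> u v; rewrite !in_mod4_part2 => u_odd v_odd.
  by apply/negP => /adj_odd; lia.
Qed.

(** * Residue classes up to sign *)

Definition residue_class (p n r : nat) : {set Gpn p n} :=
  [set v | dist_multiple p (half_label v) == r].

Lemma partition_residue_class p n : 0 < p <= n ->
  partition_into [seq residue_class p n r | r <- iota 0 p./2.+1].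
Proof.
move=> /andP[p_gt0 p_le_n]; have [_ half_labelP] := labels_half_label p n.
apply: (@partition_into_fibers _ _
          (fun v : Gpn p n => dist_multiple p (half_label v))).
- exact: iota_uniq.
- by move=> v; rewrite mem_iota /dist_multiple; lia.
move=> r; rewrite mem_iota => r_le.
have /half_labelP[v vE] : 0 < (if r == 0 then p else r) <= n by case: eqP; lia.
exists v; rewrite vE /dist_multiple; case: eqP => [->|r_neq0].
  by rewrite modnn min0n.
by rewrite modn_small; lia.
Qed.

Lemma independent_residue_class0 p n : 0 < p -> independent (residue_class p n 0).
Proof.
move=> p_gt0 u v; rewrite !inE !dist_multiple_eq0 // adj_half_label => dvd_u dvd_v.
have /andP[u_gt0 _] := half_label_bound u.
by have /andP[v_gt0 _] := half_label_bound v; rewrite half_adj_dvd.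
Qed.

Lemma adj_residue_class p n r s (u v : Gpn p n) : 0 < p -> r != s ->
    u \in residue_class p n r -> v \in residue_class p n s ->
  adj u v = opposite (mod4_part p n 0) (mod4_part p n 2) u v.
Proof.
move=> p_gt0 rs; rewrite !inE => /eqP ur /eqP vs.
by rewrite opposite_mod4_part adj_half_label half_adj_neq_dist // ur vs.
Qed.

(* The k-th integer congruent to r modulo p, counting up from the least one that
   is at least -n. *)
Definition signed_residue (p n r k : nat) : int :=
  (r%:Z + p%:Z * (k%:Z - ((n + r) %/ p)%:Z))%R.

Definition residue_class_size (p n r : nat) : nat :=
  ((n + r) %/ p + (n - r) %/ p).+1.

Section ResiduePath.
Variables p n r : nat.
Hypotheses (p_odd : odd p) (r_gt0 : 0 < r) (r_lt : 2 * r < p) (r_le_n : r <= n).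

Local Notation z := (signed_residue p n r).

Let p_gt0 : 0 < p. Proof. exact: odd_gt0. Qed.

Lemma signed_residueB k k' : `|(z k - z k')%R| = p * `|k - k'|.
Proof.
have -> : (z k - z k' = p%:Z * (k%:Z - k'%:Z))%R.
  by rewrite /signed_residue; lia.
by rewrite abszM.
Qed.

Lemma signed_residueD_ndvd k k' : ~~ (p %| `|(z k + z k')%R|).
Proof.
set B := (n + r) %/ p.
have -> : (z k + z k' = (2 * r)%:Z + p%:Z * (k%:Z + k'%:Z - 2 * B%:Z))%R.
  by rewrite /signed_residue -/B; lia.
rewrite -[_ %| _]/(p%:Z %| _)%Z GRing.rpredDr ?dvdz_mulr //.
by rewrite -[(_ %| _)%Z]/(p %| 2 * r) gtnNdvd // muln_gt0.
Qed.

Lemma signed_residueD_neq0 k k' : (z k + z k' != 0)%R.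
Proof.
by have := signed_residueD_ndvd k k'; apply: contraNneq => ->; rewrite dvdn0.
Qed.

Lemma dist_multiple_signed_residue k : dist_multiple p `|z k| = r.
Proof.
apply/eqP; rewrite dist_multiple_absz //; last exact: ltnW.
apply/orP; right; rewrite /signed_residue.
have -> : (r%:Z + p%:Z * (k%:Z - ((n + r) %/ p)%:Z) - r%:Z
           = p%:Z * (k%:Z - ((n + r) %/ p)%:Z))%R by lia.
by rewrite abszM dvdn_mulr.
Qed.

Lemma half_adj_signed_residue k k' :
  half_adj p `|z k| `|z k'| = (k' == k.+1) || (k == k'.+1).
Proof.
rewrite half_adj_congruent ?signed_residueD_ndvd ?signed_residueB ?dvdn_mulr //.
by rewrite -{2}[p]muln1 eqn_pmul2l //; lia.
Qed.

Lemma signed_residue_bound k :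
  k < residue_class_size p n r -> 0 < `|z k| <= n.
Proof.
have := leq_trunc_div (n + r) p; have := leq_trunc_div (n - r) p.
have := signed_residueD_neq0 k k.
rewrite /signed_residue /residue_class_size.
by move: ((n + r) %/ p) ((n - r) %/ p) => B A; nia.
Qed.

Lemma signed_residue_onto (x : int) :
    `|x| <= n -> p %| `|(x - r%:Z)%R| ->
  exists2 k, k < residue_class_size p n r & z k = x.
Proof.
rewrite /signed_residue /residue_class_size.
have := ltn_ceil (n - r) p_gt0; have := ltn_ceil (n + r) p_gt0.
move: ((n + r) %/ p) ((n - r) %/ p) => B A B_bound A_bound x_le.
move=> /(@dvdzP p (x - r%:Z)%R)[q xE].
have {xE} : (x = r%:Z + p%:Z * (q + B%:Z - B%:Z))%R by lia.
case: (q + B%:Z)%R => [k|k] xE; last by exfalso; nia.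
by exists k => //; rewrite -(ltn_pmul2l p_gt0); nia.
Qed.

Lemma labels_signed_residue :
  labels (predI (fun i => 0 < i <= n) (fun i => dist_multiple p i == r))
         (fun k : 'I_(residue_class_size p n r) => `|z k|).
Proof.
split=> [k k' abs_eq | i].
  have sub0 : (z k - z k' = 0)%R by have := signed_residueD_neq0 k k'; lia.
  have /eqP := signed_residueB k k'; rewrite sub0 eq_sym muln_eq0.
  by case/orP=> [|/eqP kk']; [lia | apply: val_inj => /=; lia].
split=> [/andP[/= i_bound] | [k <-]]; last first.
  by rewrite /= dist_multiple_signed_residue eqxx signed_residue_bound.
rewrite (@dist_multiple_absz p r i) //; last exact: ltnW.
move=> dvd_i.
have [x xE dvd_x] : exists2 x : int, `|x| = i & p %| `|(x - r%:Z)%R|.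
  case/orP: dvd_i => dvd_i; last by exists i.
  exists (- i%:Z)%R; first lia.
  by rewrite -GRing.opprD abszN.
have [|k k_lt kE] := @signed_residue_onto x _ dvd_x; first lia.
by exists (Ordinal k_lt); rewrite /= kE.
Qed.

Lemma induces_path_residue_class : induces_path (residue_class p n r).
Proof.
exists (residue_class_size p n r) => //.
have class_labels :=
  labels_induced (fun i => dist_multiple p i == r) (labels_half_label p n).
apply: (@graph_iso_labels (induced _) (path_graph _) _ _ (half_adj p) _ _
          class_labels labels_signed_residue).
- by move=> u v; rewrite -adj_half_label.
- by move=> k k'; rewrite half_adj_signed_residue.
Qed.

End ResiduePath.

(** * Nearly complete bipartite graphs *)

Lemma graph_iso_Gpn_lt3p p n (H : sgraph) (e : H -> nat) :
    odd p -> 2 * n < 3 * p -> labels (fun i => 0 < i <= n) e ->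
    (forall x y, adj x y = odd (e x + e y)) ->
  graph_iso (Gpn p n) H.
Proof.
move=> p_odd n_lt e_labels adjE; have [_ eP] := e_labels.
apply: (graph_iso_labels (labels_half_label p n) e_labels (@adj_half_label p n)).
move=> x y; have x_bound : 0 < e x <= n by apply/eP; exists x.
have y_bound : 0 < e y <= n by apply/eP; exists y.
by rewrite adjE half_adj_lt3p //; lia.
Qed.

Lemma labels_ord_succ n : labels (fun i => 0 < i <= n) (fun i : 'I_n => i.+1).
Proof.
split=> [i j [/val_inj] // | i]; split=> [|[j <-]]; last by rewrite ltn_ord.
by case: i => // i i_lt; exists (Ordinal i_lt).
Qed.

Lemma graph_iso_Gpn_ord p n (a : rel 'I_n) (a_sym : symmetric a)
    (a_irr : irreflexive a) :
    odd p -> 2 * n < 3 * p -> (forall i j, a i j = odd (i + j)) ->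
  graph_iso (Gpn p n) (SGraph a_sym a_irr).
Proof.
move=> p_odd n_lt aE.
apply: (@graph_iso_Gpn_lt3p _ _ (SGraph a_sym a_irr) _ p_odd n_lt
          (labels_ord_succ n)).
by move=> i j; rewrite [LHS]aE addSn addnS /= negbK.
Qed.

Definition biclique_label r s (x : biclique r s) : nat :=
  match x with inl i => 2 * i + 2 | inr j => 2 * j + 1 end.

Lemma labels_biclique_label n :
  labels (fun i => 0 < i <= n) (@biclique_label n./2 (uphalf n)).
Proof.
split=> [[i|i] [j|j] /= ij|i]; try lia.
- by congr inl; apply: val_inj => /=; lia.
- by congr inr; apply: val_inj => /=; lia.
split=> [i_bound|[[j|j] <-]] /=; try (by have := ltn_ord j; lia).
case: (boolP (odd i)) => i_parity.
  have i_lt : i./2 < uphalf n by lia.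
  by exists (inr (Ordinal i_lt)); rewrite /=; lia.
have i_lt : i./2.-1 < n./2 by lia.
by exists (inl (Ordinal i_lt)); rewrite /=; lia.
Qed.

Lemma biclique_adjE r s (x y : biclique r s) :
  adj x y = odd (biclique_label x + biclique_label y).
Proof. by case: x y => [i|i] [j|j] /=; lia. Qed.

Lemma graph_iso_Gpn_biclique p n :
  odd p -> 2 * n < 3 * p -> graph_iso (Gpn p n) (biclique n./2 (uphalf n)).
Proof.
move=> p_odd n_lt.
exact: graph_iso_Gpn_lt3p p_odd n_lt (labels_biclique_label n)
         (@biclique_adjE _ _).
Qed.

Lemma graph_iso_Gpn_del_biclique p n
    (F : {set {set biclique n./2 (uphalf n)}}) :
    odd p -> 2 * n < 5 * p ->
    (forall (i : 'I_n./2) (j : 'I_(uphalf n)),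
       ([set inl i; inr j] \in F) = (2 * (i + j) + 3 == 3 * p)) ->
  graph_iso (Gpn p n) (del_edges F).
Proof.
move=> p_odd n_lt FE; have [_ labelP] := labels_biclique_label n.
apply: (@graph_iso_labels _ (del_edges F) _ _ _ _ _ (labels_half_label p n)
          (labels_biclique_label n) (@adj_half_label p n)) => x y.
have x_bound : 0 < biclique_label x <= n by apply/labelP; exists x.
have y_bound : 0 < biclique_label y <= n by apply/labelP; exists y.
rewrite [LHS]/= /del_adj biclique_adjE.
case: (boolP (odd _)) => [xy_odd | /negPf xy_even] /=; last first.
  by rewrite half_adj_lt5p ?xy_even //; lia.
rewrite half_adj_lt5p ?xy_odd //=; try lia; congr (~~ _).
case: x y xy_odd {x_bound y_bound} => [i|i] [j|j] /= xy_odd; try lia.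
- by rewrite FE; lia.
- by rewrite setUC FE; lia.
Qed.

Lemma eq_biclique_edge r s (i a : 'I_r) (j b : 'I_s) :
  ([set inl i; inr j] == [set inl a; inr b] :> {set biclique r s})
  = (i == a) && (j == b).
Proof.
apply/eqP/andP => [/setP set_eq | [/eqP-> /eqP->]] //.
move: (set_eq (inl i)) (set_eq (inr j)); rewrite !inE !eqxx /= orbF.
by move=> /esym/eqP[->] /esym/eqP[->].
Qed.

Lemma biclique_edge r s (a : 'I_r) (b : 'I_s) :
  [set inl a; inr b] \in edge_set (biclique r s).
Proof.
rewrite inE; apply/existsP; exists (inl a).
by apply/existsP; exists (inr b) => /=.
Qed.

Lemma disjoint_biclique_edges r s (i a : 'I_r) (j b : 'I_s) :
  [disjoint [set inl i; inr j] & [set inl a; inr b] : {set biclique r s}]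
  = (i != a) && (j != b).
Proof.
rewrite -setI_eq0 -negb_or; apply/eqP/norP => [/setP disj | [ia jb]].
  split; apply/eqP => eq_ab.
  - by have := disj (inl i); rewrite !inE eq_ab !eqxx.
  - by have := disj (inr j); rewrite !inE eq_ab !eqxx.
apply/setP=> -[x|x]; rewrite !inE /= ?orbF /=;
  by apply/negP => /andP[/eqP[->] /eqP[]] /eqP; apply/negP.
Qed.

Lemma Gpn5_8_del_edge :
  exists2 e : {set biclique 4 4}, e \in edge_set (biclique 4 4) &
    graph_iso (Gpn 5 8) (del_edges [set e]).
Proof.
exists [set inl (inord 3); inr (inord 3)]; first exact: biclique_edge.
apply: (@graph_iso_Gpn_del_biclique 5 8) => // i j.
rewrite inE eq_biclique_edge -!val_eqE /= !inordK //.
by have := ltn_ord i; have := ltn_ord j; rewrite /=; lia.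
Qed.

Lemma Gpn5_9_del_edges :
  exists e1 e2 : {set biclique 4 5},
    [/\ e1 \in edge_set (biclique 4 5),
        e2 \in edge_set (biclique 4 5),
        [disjoint e1 & e2]
      & graph_iso (Gpn 5 9) (del_edges [set e1; e2])].
Proof.
exists [set inl (inord 3); inr (inord 3)], [set inl (inord 2); inr (inord 4)].
split; try exact: biclique_edge.
  by rewrite disjoint_biclique_edges -!val_eqE /= !inordK.
apply: (@graph_iso_Gpn_del_biclique 5 9) => // i j.
rewrite !inE !eq_biclique_edge -!val_eqE /= !inordK //.
by have := ltn_ord i; have := ltn_ord j; rewrite /=; lia.
Qed.

Theorem theorem5p2 :
  (forall n : nat, 10 <= n ->
     let G := Gpn 5 n in
     let X : {set G} := mod4_part 5 n 0 in
     let Y : {set G} := mod4_part 5 n 2 in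
     bipartite_with X Y /\
     exists I Q1 Q2 : {set G},
       [/\ partition_into [:: I; Q1; Q2],
           independent I,
           induces_path Q1 /\ induces_path Q2,
           (forall u v : G, u \in Q1 -> v \in I :|: Q2 ->
              opposite X Y u v -> adj u v) /\
           (forall u v : G, u \in Q2 -> v \in I :|: Q1 ->
              opposite X Y u v -> adj u v)
         & forall e : {set G}, e \in edge_set G ->
             exists u v : G, e = [set u; v] /\
               [\/ [/\ u \in Q1, v \in I :|: Q2 & opposite X Y u v],
                   [/\ u \in Q2, v \in I :|: Q1 & opposite X Y u v],
                   u \in Q1 /\ v \in Q1
                 | u \in Q2 /\ v \in Q2]]) /\
  graph_iso (Gpn 5 1) (complete_graph 1) /\
  graph_iso (Gpn 5 2) (complete_graph 2) /\
  graph_iso (Gpn 5 3) (path_graph 3) /\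
  graph_iso (Gpn 5 4) (cycle_graph 4) /\
  graph_iso (Gpn 5 5) (biclique 2 3) /\
  graph_iso (Gpn 5 6) (biclique 3 3) /\
  graph_iso (Gpn 5 7) (biclique 3 4) /\
  (exists2 e : {set biclique 4 4}, e \in edge_set (biclique 4 4) &
     graph_iso (Gpn 5 8) (del_edges [set e])) /\
  (exists e1 e2 : {set biclique 4 5},
     [/\ e1 \in edge_set (biclique 4 5),
         e2 \in edge_set (biclique 4 5),
         [disjoint e1 & e2]
       & graph_iso (Gpn 5 9) (del_edges [set e1; e2])]).
Proof.
split=> [n n_ge10 G X Y|].
  have XY : bipartite_with X Y by apply: bipartite_mod4_part; lia.
  have IQ : partition_into [seq residue_class 5 n r | r <- iota 0 3].
    by apply: (@partition_residue_class 5); lia.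
  have indI := @independent_residue_class0 5 n isT.
  split=> //.
  exists (residue_class 5 n 0), (residue_class 5 n 1), (residue_class 5 n 2).
  split=> //; last by move=> e; apply: edge_bipartite_partition3.
  - by split; apply: induces_path_residue_class; lia.
  - by split=> u v uQ /setUP[] vS; rewrite (adj_residue_class _ _ uQ vS).
split; first by apply: graph_iso_Gpn_ord => // -[[|?] ?] [[|?] ?].
split; first by apply: graph_iso_Gpn_ord => // -[[|[|?]] ?] [[|[|?]] ?].
split; first by apply: graph_iso_Gpn_ord => // -[[|[|[|?]]] ?] [[|[|[|?]]] ?].
split.
  by apply: graph_iso_Gpn_ord => // -[[|[|[|[|?]]]] ?] [[|[|[|[|?]]]] ?].
split; first exact: (@graph_iso_Gpn_biclique 5 5).
split; first exact: (@graph_iso_Gpn_biclique 5 6).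
split; first exact: (@graph_iso_Gpn_biclique 5 7).
by split; [exact: Gpn5_8_del_edge | exact: Gpn5_9_del_edges].
Qed.
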